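(* Let $a\in(-1,1)$ and let $N,M:[0,1]\to\mathbb{R}$ be twice continuously differentiable. Assume that for all $s\in\mathbb{C}$, $\operatorname{rank}[F_0(s),F_1(s)]=1$ (that is, $F_0$ and $F_1$ have no common zero in $\mathbb{C}$), that $aM(0)-M(1)\neq 0$, and that $F_0(0)\neq 0$. Let $f,g:[0,1]\to\mathbb{R}$ be continuously differentiable functions such that $I_1(\nu)=0$ for all $\nu\in[0,1]$ and $I_3(\nu)=0$ for all $\nu\in[1,2]$. Then the closed-loop system consisting of the plant $$x(t)=a\,x(t-1)+\int_0^{1}N(\nu)x(t-\nu)\,d\nu+\int_0^{1}M(\nu)U(t-\nu)\,d\nu,\qquad t\ge 0,$$ and the control law $$U(t)=\int_0^{1}\bigl(f'(\nu)x(t-\nu)+g(\nu)U(t-\nu)\bigr)\,d\nu+f(0)\,x(t)-f(1)\,x(t-1),\qquad t\ge 0,$$ is exponentially stable.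
   Context: The holomorphic functions $F_0,F_1:\mathbb{C}\to\mathbb{C}$ are $$F_0(s)=1-a e^{-s}-\int_0^{1}N(\nu)e^{-\nu s}\,d\nu,\qquad F_1(s)=\int_0^{1}M(\nu)e^{-\nu s}\,d\nu .$$ Given $f,g:[0,1]\to\mathbb{R}$, the functions $I_1$ (on $[0,1]$) and $I_3$ (on $[1,2]$) are $$I_1(\nu)=g(\nu)+M(0)f(\nu)+N(\nu)+\int_0^\nu f(\eta)M'(\nu-\eta)\,d\eta-\int_0^\nu g(\eta)N(\nu-\eta)\,d\eta,$$ $$I_3(\nu)=-M(1)f(\nu-1)+\int_{\nu-1}^{1}f(\eta)M'(\nu-\eta)\,d\eta-a\,g(\nu-1)-\int_{\nu-1}^{1}g(\eta)N(\nu-\eta)\,d\eta .$$ $C^{pw}_1$ is the space of piecewise continuous functions $[-1,0]\to\mathbb{R}$ with the sup norm, and for a function $\phi$ on $[-1,\infty)$, $\phi_{[t]}(\theta)=\phi(t+\theta)$ for $-1\le\theta\le 0$, so $\|\phi_{[t]}\|_{C^{pw}_1}=\sup_{\theta\in[-1,0]}|\phi(t+\theta)|$. Initial data are $x^0,U^0\in C^{pw}_{1}$; a solution of the closed loop is a pair $x,U:[-1,\infty)\to\mathbb{R}$ having these as initial data (histories) and satisfying both equations for $t\ge0$. The closed-loop system is exponentially stable if there exist $\kappa>0$ and $C_0>0$ such that for all initial data $(x^0,U^0)$, all solutions satisfy, for all $t\ge 0$, $$\|x_{[t]}\|_{C^{pw}_{1}}+\|U_{[t]}\|_{C^{pw}_{1}}\le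 C_0e^{-\kappa t}\left(\|x^0\|_{C^{pw}_{1}}+\|U^0\|_{C^{pw}_{1}}\right).$$ *)

(* Defs.v *)
From Stdlib Require Import Reals.
From Coquelicot Require Export Coquelicot.
Open Scope R_scope.

(** A function on an interval [[a,b]] is represented by a total function
    [R -> R]; only its values on [[a,b]] are ever constrained or used. *)

Definition Icc (a b : R) : R -> Prop := fun x => a <= x <= b.

(** [f'] is the derivative of [f] on [[a,b]], one-sided at the endpoints:
    [is_derive] with [locally x] replaced by its trace on [[a,b]]. *)
Definition is_derive_on (a b : R) (f f' : R -> R) : Prop :=
  forall x : R, Icc a b x ->
    filterdiff f (within (Icc a b) (locally x)) (fun h : R => scal h (f' x)).

Fixpoint Ck_on (k : nat) (a b : R) (f : R -> R) : Prop :=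
  match k with
  | O => continuous_on (Icc a b) f
  | S k' => exists f' : R -> R, is_derive_on a b f f' /\ Ck_on k' a b f'
  end.

(** The values at the finitely many points [s i] are arbitrary. *)
Definition piecewise_continuous (a b : R) (phi : R -> R) : Prop :=
  exists (n : nat) (s : nat -> R),
    s O = a /\ s n = b /\
    forall i : nat, (i < n)%nat ->
      s i < s (S i) /\
      (forall t : R, s i < t < s (S i) -> continuous phi t) /\
      (exists l : R, filterlim phi (at_right (s i)) (locally l)) /\
      (exists l : R, filterlim phi (at_left (s (S i))) (locally l)).

Definition Cpw1 (phi : R -> R) : Prop := piecewise_continuous (-1) 0 phi.

(** Supremum of [|phi|] over [[-1,0]]. The supremum is taken in [Rbar]; it is
    finite for [phi] in [Cpw1], so that [real] loses nothing there. *)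
Definition norm_Cpw1 (phi : R -> R) : R :=
  real (Lub_Rbar (fun y => exists theta : R, -1 <= theta <= 0 /\ y = Rabs (phi theta))).

Definition history (phi : R -> R) (t : R) : R -> R := fun theta => phi (t + theta).

Definition Cexp (z : C) : C :=
  (exp (Re z) * cos (Im z), exp (Re z) * sin (Im z)).

Definition CRInt (h : R -> C) (a b : R) : C :=
  RInt (V := C_R_CompleteNormedModule) h a b.

Definition F0 (a : R) (N : R -> R) (s : C) : C :=
  (1 - RtoC a * Cexp (- s)
     - CRInt (fun nu => RtoC (N nu) * Cexp (- (RtoC nu * s))) 0 1)%C.

Definition F1 (M : R -> R) (s : C) : C :=
  CRInt (fun nu => RtoC (M nu) * Cexp (- (RtoC nu * s)))%C 0 1.

Definition I1 (N M M' f g : R -> R) (nu : R) : R :=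
  g nu + M 0 * f nu + N nu
  + RInt (fun eta => f eta * M' (nu - eta)) 0 nu
  - RInt (fun eta => g eta * N (nu - eta)) 0 nu.

Definition I3 (a : R) (N M M' f g : R -> R) (nu : R) : R :=
  - M 1 * f (nu - 1)
  + RInt (fun eta => f eta * M' (nu - eta)) (nu - 1) 1
  - a * g (nu - 1)
  - RInt (fun eta => g eta * N (nu - eta)) (nu - 1) 1.

Definition plant (a : R) (N M x U : R -> R) (t : R) : Prop :=
  x t = a * x (t - 1)
        + RInt (fun nu => N nu * x (t - nu)) 0 1
        + RInt (fun nu => M nu * U (t - nu)) 0 1.

Definition control_law (f f' g x U : R -> R) (t : R) : Prop :=
  U t = RInt (fun nu => f' nu * x (t - nu) + g nu * U (t - nu)) 0 1
        + f 0 * x t - f 1 * x (t - 1).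

(** The equations hold from [t = 0] on and thus determine [x 0] and [U 0].
    Hence the initial data are prescribed on [[-1,0)] only: prescribing them
    at [0] as well would impose a compatibility condition on them. A solution
    that also takes the values [x0 0] and [U0 0] at [0] is in particular one
    in this sense. *)
Definition closed_loop_solution (a : R) (N M f f' g x0 U0 x U : R -> R) : Prop :=
  (forall t : R, 0 <= t -> Cpw1 (history x t) /\ Cpw1 (history U t)) /\
  (forall theta : R, -1 <= theta < 0 -> x theta = x0 theta /\ U theta = U0 theta) /\
  (forall t : R, 0 <= t -> plant a N M x U t /\ control_law f f' g x U t).

Definition closed_loop_exponentially_stable (a : R) (N M f f' g : R -> R) : Prop :=
  exists kappa C0 : R, 0 < kappa /\ 0 < C0 /\
    forall x0 U0 : R -> R, Cpw1 x0 -> Cpw1 U0 ->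
    forall x U : R -> R, closed_loop_solution a N M f f' g x0 U0 x U ->
    forall t : R, 0 <= t ->
      norm_Cpw1 (history x t) + norm_Cpw1 (history U t)
      <= C0 * exp (- kappa * t) * (norm_Cpw1 x0 + norm_Cpw1 U0).

(* Main.v *)
Require Import Defs.
From Stdlib Require Import Reals Lra Lia.
From Coquelicot Require Import Coquelicot.
Open Scope R_scope.

(** Write hats for the transforms [int_0^1 phi nu * exp (- nu * s) dnu].  With
    [int_0^1 f' nu * exp (- nu * s) dnu + f 0 - f 1 * exp (- s) = s * f^],
    the closed loop is the homogeneous system with matrix
    [[F0, - F1], [- s f^, 1 - g^]].  Its determinant is
    [F0 (1 - g^) - s f^ F1].  Since [s F1 = M 0 - M 1 exp (- s) + M'^], this
    determinant equals [1 - a exp (- s)] minus the transform of the function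
    equal to [I1] on [[0,1]] and to [I3] on [[1,2]].  The latter vanishes by
    assumption, and the adjugate of the matrix shows that [x] and [U] each
    satisfy [y t = a * y (t - 1)] from [t = 1] on ([closed_loop_decoupled]).  As
    [|a| < 1], they decay exponentially ([exponential_decay]), once they are
    bounded on [[0,1]] by their histories, which is Gronwall's inequality
    ([growth_bound]).

    The multiplications by [1 - g^], [F1], [s f^], [F0] are carried out in the
    time domain, as convolutions on [[0,1]].  What is needed is the formula for
    the composition of two such convolutions ([conv_conv]), a consequence of
    Fubini's theorem on a triangle for a continuous kernel times a function
    that is only Riemann integrable ([fubini_triangle]).

    The data [N], [M], [f], [g] and the derivatives are first extended to the
    whole line as continuous functions, and the solutions by zero to the left
    of [-1]; neither affects the equations. *)

(** * Integrals and continuity *)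

Definition cont (v : R -> R) : Prop := forall x : R, continuous v x.
Definition cont2 (K : R -> R -> R) : Prop := forall x y : R, continuity_2d_pt K x y.

(** This is local Riemann integrability.  The factor [v] is built in because
    solutions are only ever integrated against continuous kernels, and it
    spares the theorem that a product of integrable functions is integrable. *)
Definition loc_integrable (w : R -> R) : Prop :=
  forall (v : R -> R) (a b : R), cont v -> ex_RInt (fun x => v x * w x) a b.

Lemma RInt_split (h : R -> R) (a b c : R) :
  ex_RInt h a b -> ex_RInt h b c -> RInt h a c = RInt h a b + RInt h b c.
Proof. intros H1 H2. symmetry. exact (RInt_Chasles h a b c H1 H2). Qed.

Lemma RInt_reverse (h : R -> R) (a b : R) : ex_RInt h b a -> RInt h a b = - RInt h b a.
Proof. intros H; symmetry; exact (@opp_RInt_swap R_CompleteNormedModule h b a H). Qed.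

Lemma RInt_add (h k : R -> R) (a b : R) : ex_RInt h a b -> ex_RInt k a b ->
  RInt (fun x => h x + k x) a b = RInt h a b + RInt k a b.
Proof. intros H1 H2; exact (RInt_plus h k a b H1 H2). Qed.

Lemma RInt_sub (h k : R -> R) (a b : R) : ex_RInt h a b -> ex_RInt k a b ->
  RInt (fun x => h x - k x) a b = RInt h a b - RInt k a b.
Proof. intros H1 H2; exact (RInt_minus h k a b H1 H2). Qed.

Lemma RInt_mul_const (c : R) (h : R -> R) (a b : R) : ex_RInt h a b ->
  RInt (fun x => c * h x) a b = c * RInt h a b.
Proof. intros H1; exact (RInt_scal h a b c H1). Qed.

Lemma ex_RInt_add (h k : R -> R) (a b : R) : ex_RInt h a b -> ex_RInt k a b ->
  ex_RInt (fun x => h x + k x) a b.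
Proof. intros H1 H2; exact (ex_RInt_plus h k a b H1 H2). Qed.

Lemma ex_RInt_sub (h k : R -> R) (a b : R) : ex_RInt h a b -> ex_RInt k a b ->
  ex_RInt (fun x => h x - k x) a b.
Proof. intros H1 H2; exact (ex_RInt_minus h k a b H1 H2). Qed.

Lemma ex_RInt_mul_const (c : R) (h : R -> R) (a b : R) : ex_RInt h a b ->
  ex_RInt (fun x => c * h x) a b.
Proof. intros H1; exact (ex_RInt_scal h a b c H1). Qed.

Lemma RInt_bound (h : R -> R) (a b B : R) : ex_RInt h a b ->
  (forall x, Rmin a b <= x <= Rmax a b -> Rabs (h x) <= B) ->
  Rabs (RInt h a b) <= Rabs (b - a) * B.
Proof.
  intros H HB.
  exact (norm_RInt_le_const_abs h a b (RInt h a b) B HB (RInt_correct h a b H)).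
Qed.

Lemma cont_ex_RInt (v : R -> R) (a b : R) : cont v -> ex_RInt v a b.
Proof. intros H. apply (ex_RInt_continuous v). intros; apply H. Qed.

Lemma cont_const (c : R) : cont (fun _ => c).
Proof. intros x. apply continuous_const. Qed.

Lemma cont_id : cont (fun x => x).
Proof. intros x. apply continuous_id. Qed.

Lemma cont_mult (u v : R -> R) : cont u -> cont v -> cont (fun x => u x * v x).
Proof. intros Hu Hv x. exact (continuous_mult u v x (Hu x) (Hv x)). Qed.

Lemma cont_plus (u v : R -> R) : cont u -> cont v -> cont (fun x => u x + v x).
Proof. intros Hu Hv x. exact (continuous_plus u v x (Hu x) (Hv x)). Qed.

Lemma cont_minus (u v : R -> R) : cont u -> cont v -> cont (fun x => u x - v x).
Proof. intros Hu Hv x. exact (continuous_minus u v x (Hu x) (Hv x)). Qed.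

Lemma cont_comp (u v : R -> R) : cont u -> cont v -> cont (fun x => v (u x)).
Proof. intros Hu Hv x. exact (continuous_comp u v x (Hu x) (Hv _)). Qed.

Lemma cont_ext (u v : R -> R) : (forall x, u x = v x) -> cont u -> cont v.
Proof. intros H Hu x. apply (continuous_ext u v x H). apply Hu. Qed.

Ltac cont_tac :=
  repeat lazymatch goal with
  | |- cont (fun _ => ?c) => apply (cont_const c)
  | |- cont (fun x => x) => apply cont_id
  | |- cont (fun x => @?u x - @?v x) => apply (cont_minus u v)
  | |- cont (fun x => @?u x + @?v x) => apply (cont_plus u v)
  | |- cont (fun x => @?u x * @?v x) => apply (cont_mult u v)
  | H : cont ?v |- cont ?v => exact H
  | H : cont ?v |- cont (fun x => ?v x) => exact H
  | H : cont ?v |- cont (fun x => ?v (@?u x)) => refine (cont_comp u v _ H)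
  end.

Lemma cont2_fst (v : R -> R) : cont v -> cont2 (fun x _ => v x).
Proof.
  intros H x y. apply (continuity_1d_2d_pt_comp v (fun u _ => u)).
  - apply continuity_pt_filterlim. apply H.
  - apply continuity_2d_pt_id1.
Qed.

Lemma cont2_comp (v : R -> R) (K : R -> R -> R) : cont v -> cont2 K ->
  cont2 (fun x y => v (K x y)).
Proof.
  intros H HK x y. apply (continuity_1d_2d_pt_comp v K).
  - apply continuity_pt_filterlim. apply H.
  - apply HK.
Qed.

Lemma cont2_section (K : R -> R -> R) (x : R) : cont2 K -> cont (K x).
Proof.
  intros HK y. apply continuity_pt_filterlim. intros eps Heps.
  destruct (HK x y (mkposreal eps Heps)) as [d Hd].
  exists d; split. apply cond_pos. intros z [_ Hz].
  unfold dist in *; simpl in *; unfold R_dist in *.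
  apply Hd; [rewrite Rminus_diag, Rabs_R0; apply cond_pos | exact Hz].
Qed.

Lemma cont2_swap (K : R -> R -> R) : cont2 K -> cont2 (fun x y => K y x).
Proof.
  intros HK x y eps. destruct (HK y x eps) as [d Hd]. exists d.
  intros u v Hu Hv. apply Hd; assumption.
Qed.

Lemma cont2_const c : cont2 (fun _ _ => c).
Proof. intros x y; apply continuity_2d_pt_const. Qed.
Lemma cont2_1 : cont2 (fun x _ => x).
Proof. intros x y; apply continuity_2d_pt_id1. Qed.
Lemma cont2_2 : cont2 (fun _ y => y).
Proof. intros x y; apply continuity_2d_pt_id2. Qed.
Lemma cont2_plus K L : cont2 K -> cont2 L -> cont2 (fun x y => K x y + L x y).
Proof. intros HK HL x y; apply continuity_2d_pt_plus; auto. Qed.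
Lemma cont2_minus K L : cont2 K -> cont2 L -> cont2 (fun x y => K x y - L x y).
Proof. intros HK HL x y; apply continuity_2d_pt_minus; auto. Qed.
Lemma cont2_mult K L : cont2 K -> cont2 L -> cont2 (fun x y => K x y * L x y).
Proof. intros HK HL x y; apply continuity_2d_pt_mult; auto. Qed.

Ltac cont2_tac :=
  repeat lazymatch goal with
  | |- cont2 (fun _ _ => ?c) => apply (cont2_const c)
  | |- cont2 (fun x _ => x) => apply cont2_1
  | |- cont2 (fun _ y => y) => apply cont2_2
  | |- cont2 (fun x y => @?u x y - @?v x y) => apply (cont2_minus u v)
  | |- cont2 (fun x y => @?u x y + @?v x y) => apply (cont2_plus u v)
  | |- cont2 (fun x y => @?u x y * @?v x y) => apply (cont2_mult u v)
  | H : cont ?v |- cont2 (fun x y => ?v (@?u x y)) => apply (cont2_comp v u H)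
  end.

Lemma loc_integrable_ex w a b : loc_integrable w -> ex_RInt w a b.
Proof.
  intros H. apply (ex_RInt_ext (fun x => 1 * w x)).
  intros; apply Rmult_1_l. apply (H (fun _ => 1)). apply cont_const.
Qed.

Lemma loc_integrable_bound w a b : loc_integrable w ->
  exists B, 0 <= B /\ forall x, a <= x <= b -> Rabs (w x) <= B.
Proof.
  intros H. destruct (ex_RInt_ub w a b (loc_integrable_ex w a b H)) as [B HB].
  exists (Rmax 0 B). split. apply Rmax_l. intros x Hx.
  eapply Rle_trans; [apply HB | apply Rmax_r].
  rewrite Rmin_left, Rmax_right by lra. exact Hx.
Qed.

Lemma loc_integrable_cont v : cont v -> loc_integrable v.
Proof. intros Hv u a b Hu. apply cont_ex_RInt. now apply cont_mult. Qed.

Lemma loc_integrable_reflect w t : loc_integrable w -> loc_integrable (fun s => w (t - s)).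
Proof.
  intros H v a b Hv.
  assert (Hv' : cont (fun x => v (t - x))).
  { apply (cont_comp (fun x => t - x) v); cont_tac. }
  pose proof (H (fun x => v (t - x)) (-1 * a + t) (-1 * b + t) Hv') as Hex.
  apply (ex_RInt_comp_lin _ (-1) t) in Hex.
  apply (ex_RInt_scal _ _ _ (-1)) in Hex.
  eapply ex_RInt_ext; [|exact Hex]. intros x _.
  unfold scal; simpl; unfold mult; simpl.
  replace (t - (-1 * x + t)) with x by ring.
  replace (-1 * x + t) with (t - x) by ring. ring.
Qed.

Lemma loc_integrable_shift w t : loc_integrable w -> loc_integrable (fun s => w (s + t)).
Proof.
  intros H. apply (loc_integrable_reflect _ 0) in H. apply (loc_integrable_reflect _ (- t)) in H.
  intros v a b Hv. eapply ex_RInt_ext; [|exact (H v a b Hv)].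
  intros x _; simpl. do 2 f_equal. ring.
Qed.

Lemma RInt_shift (h : R -> R) (t a b : R) : ex_RInt h (a + t) (b + t) ->
  RInt (fun s => h (s + t)) a b = RInt h (a + t) (b + t).
Proof.
  intros H.
  replace (a + t) with (1 * a + t) in * by ring.
  replace (b + t) with (1 * b + t) in * by ring.
  rewrite <- (RInt_comp_lin h 1 t a b H).
  apply RInt_ext. intros x _. unfold scal; simpl; unfold mult; simpl.
  rewrite !Rmult_1_l. reflexivity.
Qed.

Lemma RInt_reflect (h : R -> R) (t a b : R) : ex_RInt h (t - b) (t - a) ->
  RInt (fun s => h (t - s)) a b = RInt h (t - b) (t - a).
Proof.
  intros H. rewrite (RInt_reverse h (t - b)) by (apply ex_RInt_swap; exact H).
  apply ex_RInt_swap in H.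
  replace (t - a) with (-1 * a + t) in * by ring.
  replace (t - b) with (-1 * b + t) in * by ring.
  rewrite <- (RInt_comp_lin h (-1) t a b H).
  rewrite <- (Rmult_1_l (RInt _ _ _)) at 1.
  replace 1 with (-(-1)) at 1 by ring. rewrite Ropp_mult_distr_l_reverse.
  f_equal.
  symmetry. etransitivity. 2: apply RInt_mul_const.
  - apply RInt_ext. intros x _. unfold scal; simpl; unfold mult; simpl.
    f_equal. f_equal. ring.
  - apply (ex_RInt_comp_lin h (-1) t a b) in H.
    apply (ex_RInt_scal _ _ _ (-1)) in H.
    eapply ex_RInt_ext; [|exact H]. intros x _.
    unfold scal; simpl; unfold mult; simpl.
  replace (-1 * x + t) with (t - x) by ring. ring.
Qed.

Lemma uniformly_close_sections (K : R -> R -> R) (a c eps : R) : cont2 K -> 0 < eps ->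
  exists d, 0 < d /\ forall c' mu, Rabs (c' - c) < d -> Rmin a c <= mu <= Rmax a c ->
    Rabs (K c' mu - K c mu) < eps.
Proof.
  intros HK He.
  destruct (uniform_continuity_2d K (c - 1) (c + 1) (Rmin a c) (Rmax a c)
     (fun x y _ _ => HK x y) (mkposreal eps He)) as [d Hd]; simpl in Hd.
  exists (Rmin 1 d). split. apply Rmin_pos; [lra | apply cond_pos].
  intros c' mu Hc Hmu.
  assert (H1 : Rabs (c' - c) < 1) by (eapply Rlt_le_trans; [exact Hc | apply Rmin_l]).
  assert (H2 : Rabs (c' - c) < d) by (eapply Rlt_le_trans; [exact Hc | apply Rmin_r]).
  apply Rabs_def2 in H1.
  apply Hd; try lra. rewrite Rminus_diag, Rabs_R0; apply cond_pos.
Qed.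

Lemma bounded_near (K : R -> R -> R) (c : R) : cont2 K ->
  exists B d, 0 < B /\ 0 < d /\ forall x y, Rabs (x - c) < d -> Rabs (y - c) < d ->
     Rabs (K x y) <= B.
Proof.
  intros HK. destruct (HK c c (mkposreal 1 Rlt_0_1)) as [d Hd]; simpl in Hd.
  exists (Rabs (K c c) + 1), d. split. pose proof (Rabs_pos (K c c)); lra.
  split. apply cond_pos. intros x y Hx Hy. specialize (Hd x y Hx Hy).
  replace (K x y) with ((K x y - K c c) + K c c) by ring.
  eapply Rle_trans; [apply Rabs_triang | lra].
Qed.

Lemma between_near c c' mu d : Rabs (c' - c) < d -> Rmin c c' <= mu <= Rmax c c' ->
  Rabs (mu - c) < d.
Proof.
  intros H Hm. apply Rabs_def2 in H. apply Rabs_def1.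
  unfold Rmin, Rmax in Hm; destruct (Rle_dec c c'); lra.
  unfold Rmin, Rmax in Hm; destruct (Rle_dec c c'); lra.
Qed.

Lemma cont_of_eps (v : R -> R) :
  (forall c eps, 0 < eps -> exists d, 0 < d /\ forall c', Rabs (c' - c) < d ->
     Rabs (v c' - v c) <= eps) -> cont v.
Proof.
  intros H c. apply continuity_pt_filterlim. intros eps Heps.
  destruct (H c (eps / 2)) as [d [Hd Hd']]; [lra|]. exists d; split; [lra|].
  intros x [_ Hx]. unfold dist in *; simpl in *; unfold R_dist in *.
  specialize (Hd' x Hx). lra.
Qed.

Lemma is_derive_of_eps (v : R -> R) (c l : R) :
  (forall eps, 0 < eps -> exists d, 0 < d /\ forall c', Rabs (c' - c) < d ->
     Rabs (v c' - v c - (c' - c) * l) <= eps * Rabs (c' - c)) -> is_derive v c l.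
Proof.
  intros H. apply is_derive_Reals. intros eps Heps.
  destruct (H (eps / 2)) as [d [Hd Hd']]; [lra|]. exists (mkposreal d Hd).
  intros h Hh Hhd; simpl in Hhd. specialize (Hd' (c + h)).
  replace (c + h - c) with h in Hd' by ring. specialize (Hd' Hhd).
  assert (0 < Rabs h) by now apply Rabs_pos_lt.
  replace ((v (c + h) - v c) / h - l) with ((v (c + h) - v c - h * l) / h) by (field; auto).
  unfold Rdiv at 1. rewrite Rabs_mult, Rabs_inv.
  apply Rle_lt_trans with (eps / 2). 2: lra.
  apply (Rmult_le_reg_r (Rabs h)); auto. rewrite Rmult_assoc, Rinv_l by lra. lra.
Qed.

(** * Fubini's theorem on a triangle *)

(** The next two lemmas take a limit [c' -> c] in an integral from [a] to [c']
    whose kernel depends on [c'] too.  The strip between [c] and [c'] is short,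
    with integrand at most [B * W]; over the fixed part [[a,c]] the kernel moves
    by at most [e].  The choice of [d] and [e] makes each of these two errors at
    most [eps / 2]. *)
Lemma moving_limit_estimates (K : R -> R -> R) (w : R -> R) (a c eps : R) :
  cont2 K -> loc_integrable w -> 0 < eps ->
  exists d B W e, 0 < d /\ 0 <= B /\ 0 <= W /\ 0 <= e /\
    d * (B * W) <= eps / 2 /\ Rabs (c - a) * (e * W) <= eps / 2 /\
    (forall s, Rabs (s - c) < d -> Rabs (w s) <= W) /\
    (forall s, Rmin a c <= s <= Rmax a c -> Rabs (w s) <= W) /\
    (forall nu mu, Rabs (nu - c) < d -> Rabs (mu - c) < d -> Rabs (K nu mu) <= B) /\
    (forall nu mu, Rabs (nu - c) < d -> Rmin a c <= mu <= Rmax a c ->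
      Rabs (K nu mu - K c mu) <= e).
Proof.
  intros HK Hw Heps.
  destruct (loc_integrable_bound w (Rmin a c - 1) (Rmax a c + 1) Hw) as [W [HW0 HW]].
  destruct (bounded_near K c HK) as [B [d1 [HB [Hd1 HKB]]]].
  set (L := Rabs (c - a)).
  assert (HL : 0 <= L) by apply Rabs_pos.
  assert (HLW : 0 <= L * W) by now apply Rmult_le_pos.
  assert (HBW : 0 <= B * W) by (apply Rmult_le_pos; lra).
  (* [L * W] and [B * W] may vanish, hence the [+ 1] in the denominators *)
  set (e := eps / 2 / (L * W + 1)).
  assert (He : 0 < e) by (apply Rdiv_lt_0_compat; lra).
  destruct (uniformly_close_sections K a c e HK He) as [d2 [Hd2 HK2]].
  set (d3 := eps / 2 / (B * W + 1)).
  assert (Hd3 : 0 < d3) by (apply Rdiv_lt_0_compat; lra).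
  set (d := Rmin (Rmin 1 d1) (Rmin d2 d3)).
  assert (Hd : 0 < d) by (unfold d; repeat apply Rmin_pos; lra).
  assert (Hdle : d <= 1 /\ d <= d1 /\ d <= d2 /\ d <= d3).
  { unfold d. pose proof (Rmin_l (Rmin 1 d1) (Rmin d2 d3)).
    pose proof (Rmin_r (Rmin 1 d1) (Rmin d2 d3)).
    pose proof (Rmin_l 1 d1). pose proof (Rmin_r 1 d1).
    pose proof (Rmin_l d2 d3). pose proof (Rmin_r d2 d3). lra. }
  exists d, B, W, e. repeat split; try lra.
  - apply Rle_trans with (d3 * (B * W + 1)).
    + apply Rmult_le_compat; lra.
    + unfold d3. right; field; lra.
  - apply Rle_trans with (e * (L * W + 1)).
    + ring_simplify; lra.
    + unfold e. right; field; lra.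
  - intros s Hs. apply HW. apply Rabs_def2 in Hs.
    pose proof (Rmin_r a c). pose proof (Rmax_r a c). lra.
  - intros s Hs. apply HW; lra.
  - intros nu mu Hnu Hmu. apply HKB; lra.
  - intros nu mu Hnu Hmu. apply Rlt_le, HK2; lra.
Qed.

Lemma cont_RInt_param (K : R -> R -> R) (w : R -> R) (a : R) : cont2 K -> loc_integrable w ->
  cont (fun c => RInt (fun mu => K c mu * w mu) a c).
Proof.
  intros HK Hw. apply cont_of_eps. intros c eps Heps.
  destruct (moving_limit_estimates K w a c eps HK Hw Heps)
    as [d [B [W [e [Hd [HB [HW [He [Hshort [Hlong [Hw1 [Hw2 [HK1 HK2]]]]]]]]]]]]].
  exists d. split; auto. intros c' Hc'.
  assert (EK : forall x p q, ex_RInt (fun mu => K x mu * w mu) p q).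
  { intros x p q. apply Hw. now apply cont2_section. }
  rewrite (RInt_split _ a c c') by apply EK.
  replace (_ + _ - _) with (RInt (fun mu => K c' mu * w mu) c c' +
     RInt (fun mu => K c' mu * w mu - K c mu * w mu) a c)
    by (rewrite RInt_sub by apply EK; ring).
  eapply Rle_trans; [apply Rabs_triang|].
  assert (H1 : Rabs (RInt (fun mu => K c' mu * w mu) c c') <= Rabs (c' - c) * (B * W)).
  { apply RInt_bound. apply EK. intros mu Hmu.
    pose proof (between_near c c' mu d Hc' Hmu) as Hn.
    rewrite Rabs_mult. apply Rmult_le_compat; auto using Rabs_pos. }
  assert (H2 : Rabs (RInt (fun mu => K c' mu * w mu - K c mu * w mu) a c)
    <= Rabs (c - a) * (e * W)).
  { apply RInt_bound. apply ex_RInt_sub; apply EK. intros mu Hmu.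
    rewrite <- Rmult_minus_distr_r, Rabs_mult.
    apply Rmult_le_compat; auto using Rabs_pos. }
  assert (H3 : Rabs (c' - c) * (B * W) <= d * (B * W)).
  { apply Rmult_le_compat_r; [apply Rmult_le_pos|]; lra. }
  lra.
Qed.

(** Both sides, as functions of [b], vanish at [b = a] and have derivative
    [int_a^b K b mu * w mu dmu], which is continuous although [w] is not.  For
    the left side this is the fundamental theorem.  On the right, moving [b]
    to [b + h] adds a strip of length [h] on which the inner integral is
    [O(h)], and adds [int_b^(b+h) K nu mu dnu] to the inner integral, which is
    [h * K b mu] up to [o(h)] uniformly in [mu]. *)
Lemma fubini_triangle (K : R -> R -> R) (w : R -> R) (a b : R) : cont2 K -> loc_integrable w ->
  RInt (fun nu => RInt (fun mu => K nu mu * w mu) a nu) a b =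
  RInt (fun mu => RInt (fun nu => K nu mu) mu b * w mu) a b.
Proof.
  intros HK Hw.
  set (J := fun nu => RInt (fun mu => K nu mu * w mu) a nu).
  set (S := fun c => RInt (fun mu => RInt (fun nu => K nu mu) mu c * w mu) a c).
  assert (EK : forall x p q, ex_RInt (fun mu => K x mu * w mu) p q).
  { intros x p q. apply Hw. now apply cont2_section. }
  assert (Ek : forall y p q, ex_RInt (fun nu => K nu y) p q).
  { intros y p q. apply cont_ex_RInt. apply (cont2_section _ y (cont2_swap K HK)). }
  assert (Ck : forall c, cont (fun mu => RInt (fun nu => K nu mu) mu c)).
  { intros c.
    apply (cont_ext (fun mu => -1 * RInt (fun nu => K nu mu * 1) c mu)).
    { intros y. rewrite (RInt_reverse _ y c) by auto.
      rewrite (RInt_ext (fun nu => K nu y * 1) (fun nu => K nu y)). simpl; ring.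
      intros; apply Rmult_1_r. }
    apply cont_mult. apply cont_const.
    apply (cont_RInt_param (fun x y => K y x) (fun _ => 1)). now apply cont2_swap.
    apply loc_integrable_cont, cont_const. }
  assert (ES : forall c p q, ex_RInt (fun mu => RInt (fun nu => K nu mu) mu c * w mu) p q).
  { intros c p q. apply Hw. apply Ck. }
  assert (HS : forall c, is_derive S c (J c)).
  { intros c. apply is_derive_of_eps. intros eps Heps.
    destruct (moving_limit_estimates K w a c eps HK Hw Heps)
      as [d [B [W [e [Hd [HB [HW [He [Hshort [Hlong [Hw1 [Hw2 [HK1 HK2]]]]]]]]]]]]].
    exists d. split; auto. intros c' Hc'.
    assert (EQ : S c' - S c - (c' - c) * J c =
      RInt (fun mu => RInt (fun nu => K nu mu) mu c' * w mu) c c' +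
      RInt (fun mu => (RInt (fun nu => K nu mu) mu c' * w mu
         - RInt (fun nu => K nu mu) mu c * w mu) - (c' - c) * (K c mu * w mu)) a c).
    { unfold S, J. rewrite (RInt_split _ a c c') by apply ES.
      rewrite RInt_sub, RInt_sub, RInt_mul_const; auto using ex_RInt_sub, ex_RInt_mul_const. ring. }
    rewrite EQ. clear EQ.
    eapply Rle_trans; [apply Rabs_triang|].
    set (h := Rabs (c' - c)) in *.
    assert (Hh : 0 <= h) by apply Rabs_pos.
    assert (H1 : Rabs (RInt (fun mu => RInt (fun nu => K nu mu) mu c' * w mu) c c')
       <= h * (h * B * W)).
    { apply RInt_bound. apply ES. intros mu Hmu.
      pose proof (between_near c c' mu d Hc' Hmu) as Hn.
      rewrite Rabs_mult. apply Rmult_le_compat; auto using Rabs_pos.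
      apply Rle_trans with (Rabs (c' - mu) * B).
      - apply RInt_bound. apply Ek. intros nu Hnu.
        assert (Rabs (nu - c) < d).
        { apply Rabs_def2 in Hn. unfold h in Hc'. apply Rabs_def2 in Hc'. apply Rabs_def1;
          unfold Rmin, Rmax in Hnu; destruct (Rle_dec mu c'); lra. }
        auto.
      - apply Rmult_le_compat_r; auto. unfold h.
        unfold Rmin, Rmax in Hmu; destruct (Rle_dec c c').
        rewrite !Rabs_pos_eq; lra. rewrite !Rabs_left1; lra. }
    match goal with |- _ + Rabs ?I <= _ =>
      assert (H2 : Rabs I <= Rabs (c - a) * (h * e * W)) end.
    { apply RInt_bound. auto using ex_RInt_sub, ex_RInt_mul_const. intros mu Hmu.
      replace (_ - _) with ((RInt (fun nu => K nu mu - K c mu) c c') * w mu).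
      - rewrite Rabs_mult. apply Rmult_le_compat; auto using Rabs_pos.
        apply RInt_bound. apply ex_RInt_sub; auto. apply cont_ex_RInt, cont_const.
        intros nu Hnu. apply HK2; auto. exact (between_near c c' nu d Hc' Hnu).
      - rewrite RInt_sub; auto. 2: apply cont_ex_RInt, cont_const.
        rewrite (RInt_split _ mu c c') by auto.
        rewrite (RInt_const c c' (K c mu) : _ = (c' - c) * K c mu). ring. }
    assert (H3 : h * (h * B * W) <= h * (d * (B * W))).
    { apply Rmult_le_compat_l; auto. rewrite Rmult_assoc.
      apply Rmult_le_compat_r; [apply Rmult_le_pos|]; lra. }
    assert (H4 : h * (d * (B * W)) <= h * (eps / 2)) by now apply Rmult_le_compat_l.
    assert (H5 : h * (Rabs (c - a) * (e * W)) <= h * (eps / 2)) by now apply Rmult_le_compat_l.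
    lra. }
  assert (HJ : cont J) by exact (cont_RInt_param K w a HK Hw).
  pose proof (is_RInt_derive S J a b (fun x _ => HS x) (fun x _ => HJ x)) as HI.
  apply is_RInt_unique in HI. fold J.
  rewrite HI. unfold minus, plus, opp; simpl.
  change (S b + - S a = S b).
  unfold S at 2. rewrite (RInt_point a _ : _ = 0). ring.
Qed.

(** * Convolutions on the unit interval *)

(** Convolution with the kernel equal to [phi] on [[0,1]] and zero elsewhere. *)
Definition conv (phi w : R -> R) (t : R) : R := RInt (fun nu => phi nu * w (t - nu)) 0 1.

(** The convolution of two kernels carried by [[0,1]] is carried by [[0,2]];
    [conv_head] is its restriction to [[0,1]], and [conv_tail] its restriction to
    [[1,2]] translated back to [[0,1]]. *)
Definition conv_head (phi psi : R -> R) (mu : R) : R :=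
  RInt (fun nu => phi nu * psi (mu - nu)) 0 mu.
Definition conv_tail (phi psi : R -> R) (mu : R) : R :=
  RInt (fun nu => phi nu * psi (1 + mu - nu)) mu 1.

Lemma conv_ex phi w t a b : cont phi -> loc_integrable w ->
  ex_RInt (fun nu => phi nu * w (t - nu)) a b.
Proof. intros Hphi Hw. exact (loc_integrable_reflect w t Hw phi a b Hphi). Qed.

Lemma cont_conv_head phi psi : cont phi -> cont psi -> cont (conv_head phi psi).
Proof.
  intros Hphi Hpsi.
  apply (cont_ext (fun mu => RInt (fun nu => phi nu * psi (mu - nu) * 1) 0 mu)).
  { intros y. apply RInt_ext. intros; apply Rmult_1_r. }
  apply (cont_RInt_param (fun mu nu => phi nu * psi (mu - nu)) (fun _ => 1) 0).
  - cont2_tac.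
  - apply loc_integrable_cont, cont_const.
Qed.

Lemma cont_conv_tail phi psi : cont phi -> cont psi -> cont (conv_tail phi psi).
Proof.
  intros Hphi Hpsi.
  apply (cont_ext (fun mu => -1 * RInt (fun nu => phi nu * psi (1 + mu - nu) * 1) 1 mu)).
  { intros y. unfold conv_tail. rewrite (RInt_reverse _ y 1).
    - rewrite (RInt_ext _ (fun nu => phi nu * psi (1 + y - nu))). simpl; ring.
      intros; apply Rmult_1_r.
    - apply cont_ex_RInt. apply cont_mult; auto. apply (cont_comp (fun nu => 1 + y - nu) psi); auto.
      cont_tac. }
  apply cont_mult. apply cont_const.
  apply (cont_RInt_param (fun mu nu => phi nu * psi (1 + mu - nu)) (fun _ => 1) 1).
  - cont2_tac.
  - apply loc_integrable_cont, cont_const.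
Qed.

Lemma conv_head_comm phi psi mu : cont phi -> cont psi -> conv_head phi psi mu = conv_head psi phi mu.
Proof.
  intros Hphi Hpsi. unfold conv_head.
  transitivity (RInt (fun s => (fun nu => phi nu * psi (mu - nu)) (mu - s)) 0 mu).
  - rewrite (RInt_reflect (fun nu => phi nu * psi (mu - nu)) mu 0 mu).
    + f_equal; ring.
    + apply conv_ex; auto. now apply loc_integrable_cont.
  - apply RInt_ext. intros x _. replace (mu - (mu - x)) with x by ring. apply Rmult_comm.
Qed.

Lemma conv_tail_comm phi psi mu : cont phi -> cont psi -> conv_tail phi psi mu = conv_tail psi phi mu.
Proof.
  intros Hphi Hpsi. unfold conv_tail.
  transitivity (RInt (fun s => (fun nu => phi nu * psi (1 + mu - nu)) (1 + mu - s)) mu 1).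
  - rewrite (RInt_reflect (fun nu => phi nu * psi (1 + mu - nu)) (1 + mu) mu 1).
    + f_equal; ring.
    + apply conv_ex; auto. now apply loc_integrable_cont.
  - apply RInt_ext. intros x _. replace (1 + mu - (1 + mu - x)) with x by ring. apply Rmult_comm.
Qed.

(** The change of variable [mu = t - nu] moves [t] out of [w], which may be
    discontinuous, into the kernel and the limits of integration. *)
Lemma cont_conv phi w : cont phi -> loc_integrable w -> cont (conv phi w).
Proof.
  intros Hphi Hw.
  set (G1 := fun c => RInt (fun mu => phi (c - mu) * w mu) 0 c).
  set (G2 := fun c => RInt (fun mu => phi (c + 1 - mu) * w mu) 0 c).
  assert (K1 : cont2 (fun c mu => phi (c - mu))) by cont2_tac.
  assert (K2 : cont2 (fun c mu => phi (c + 1 - mu))) by cont2_tac.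
  assert (H1 : cont G1) by (exact (cont_RInt_param (fun c mu => phi (c - mu)) w 0 K1 Hw)).
  assert (H2 : cont G2) by (exact (cont_RInt_param (fun c mu => phi (c + 1 - mu)) w 0 K2 Hw)).
  assert (E : forall t a b, ex_RInt (fun mu => phi (t - mu) * w mu) a b).
  { intros t a b. apply Hw. apply (cont_comp (fun mu => t - mu) phi); auto. cont_tac. }
  apply (cont_ext (fun t => G1 t - G2 (t - 1))).
  - intros s. unfold conv, G1, G2.
    transitivity (RInt (fun mu => phi (s - mu) * w mu) (s - 1) s).
    + rewrite (RInt_split (fun mu => phi (s - mu) * w mu) 0 (s - 1) s) by apply E.
      replace (s - 1 + 1) with s by ring. simpl. ring.
    + replace (RInt (fun mu => phi (s - mu) * w mu) (s - 1) s)
        with (RInt (fun mu => phi (s - mu) * w mu) (s - 1) (s - 0)) by (f_equal; ring).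
      rewrite <- (RInt_reflect (fun mu => phi (s - mu) * w mu) s 0 1).
      * apply RInt_ext. intros x _. f_equal. f_equal. ring.
      * apply E.
  - apply cont_minus; auto. apply (cont_comp (fun t => t - 1) G2); auto. cont_tac.
Qed.

(** The region of integration is the set of [(nu, mu)] with
    [nu <= mu <= nu + 1].  The line [mu = 1] cuts it into two triangles,
    on which [fubini_triangle] exchanges the integrals.  [K1] is the kernel
    [phi nu * psi (mu - nu)] for the part [mu <= 1], and [K2] the same kernel
    for the part [1 <= mu], with [mu] translated by one. *)
Lemma conv_conv phi psi w t : cont phi -> cont psi -> loc_integrable w ->
  conv phi (conv psi w) t = conv (conv_head phi psi) w t + conv (conv_tail phi psi) w (t - 1).
Proof.
  intros Hphi Hpsi Hw.
  set (y := fun s => w (t - s)).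
  assert (Hy : loc_integrable y) by now apply loc_integrable_reflect.
  assert (Hy1 : loc_integrable (fun s => y (s + 1))) by now apply loc_integrable_shift.
  set (K1 := fun nu mu => phi nu * psi (mu - nu)).
  set (K2 := fun nu mu => phi nu * psi (mu + 1 - nu)).
  assert (HK1 : cont2 K1) by (unfold K1; apply cont2_mult; [apply cont2_fst | cont2_tac]; auto).
  assert (HK2 : cont2 K2) by (unfold K2; apply cont2_mult; [apply cont2_fst | cont2_tac]; auto).
  assert (E1 : forall nu a b, ex_RInt (fun mu => K1 nu mu * y mu) a b).
  { intros nu a b. apply Hy. now apply cont2_section. }
  assert (E2 : forall nu a b, ex_RInt (fun mu => K2 nu mu * y (mu + 1)) a b).
  { intros nu a b. apply (Hy1 (K2 nu)). now apply cont2_section. }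
  assert (C1 : cont (fun nu => RInt (fun mu => K1 nu mu * y mu) 1 nu)) by exact (cont_RInt_param K1 y 1 HK1 Hy).
  assert (C2 : cont (fun nu => RInt (fun mu => K2 nu mu * y (mu + 1)) 0 nu)).
  { exact (cont_RInt_param K2 (fun s => y (s + 1)) 0 HK2 Hy1). }
  transitivity (RInt (fun nu => RInt (fun mu => K2 nu mu * y (mu + 1)) 0 nu
     - RInt (fun mu => K1 nu mu * y mu) 1 nu) 0 1).
  { unfold conv at 1. apply RInt_ext. intros nu _. unfold conv.
    rewrite <- RInt_mul_const by now apply conv_ex.
    transitivity (RInt (fun mu => K1 nu mu * y mu) nu (nu + 1)).
    - replace (RInt (fun mu => K1 nu mu * y mu) nu (nu + 1))
        with (RInt (fun mu => K1 nu mu * y mu) (0 + nu) (1 + nu)) by (f_equal; ring).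
      rewrite <- (RInt_shift (fun mu => K1 nu mu * y mu)) by apply E1.
      apply RInt_ext. intros x _. unfold K1, y.
      replace (x + nu - nu) with x by ring. replace (t - (x + nu)) with (t - nu - x) by ring.
      symmetry; apply Rmult_assoc.
    - rewrite (RInt_split _ nu 1) by apply E1.
      rewrite (RInt_reverse _ nu 1) by apply E1.
      replace (RInt (fun mu => K1 nu mu * y mu) 1 (nu + 1))
        with (RInt (fun mu => K1 nu mu * y mu) (0 + 1) (nu + 1)) by (f_equal; ring).
      rewrite <- (RInt_shift (fun mu => K1 nu mu * y mu)) by apply E1. unfold K1, K2. simpl; ring. }
  rewrite RInt_sub by now apply cont_ex_RInt. unfold Rminus at 1. rewrite Rplus_comm. f_equal.
  - rewrite <- RInt_reverse by now apply cont_ex_RInt.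
    rewrite (fubini_triangle K1 y 1 0 HK1 Hy).
    assert (Ck : cont (conv_head phi psi)) by now apply cont_conv_head.
    transitivity (RInt (fun mu => (-1) * (conv_head phi psi mu * y mu)) 1 0).
    + apply RInt_ext. intros mu _. rewrite RInt_reverse.
      * unfold K1, conv_head. simpl; ring.
      * apply cont_ex_RInt. apply (cont2_section _ mu (cont2_swap K1 HK1)).
    + rewrite RInt_mul_const by now apply Hy. rewrite RInt_reverse by now apply Hy.
      unfold conv, y. simpl; ring.
  - rewrite (fubini_triangle K2 _ 0 1 HK2 Hy1).
    unfold conv. apply RInt_ext. intros mu _. unfold y, K2, conv_tail.
    replace (t - (mu + 1)) with (t - 1 - mu) by ring. f_equal.
    apply RInt_ext. intros nu _. rewrite (Rplus_comm mu 1). reflexivity.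
Qed.

Lemma loc_integrable_conv phi w : cont phi -> loc_integrable w -> loc_integrable (conv phi w).
Proof. intros Hphi Hw. now apply loc_integrable_cont, cont_conv. Qed.

Lemma conv_ext_left phi psi w t : (forall nu, 0 <= nu <= 1 -> phi nu = psi nu) ->
  conv phi w t = conv psi w t.
Proof.
  intros H. apply RInt_ext. rewrite Rmin_left, Rmax_right by lra.
  intros x Hx. rewrite H; lra.
Qed.

Lemma conv_ext_right phi w z t : (forall s, t - 1 <= s <= t -> w s = z s) ->
  conv phi w t = conv phi z t.
Proof.
  intros H. apply RInt_ext. rewrite Rmin_left, Rmax_right by lra.
  intros x Hx. rewrite H; lra.
Qed.

Lemma conv_plus_l phi psi w t : cont phi -> cont psi -> loc_integrable w ->
  conv (fun nu => phi nu + psi nu) w t = conv phi w t + conv psi w t.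
Proof.
  intros. unfold conv. rewrite <- RInt_add by now apply conv_ex.
  apply RInt_ext; intros; apply Rmult_plus_distr_r.
Qed.

Lemma conv_scal_l c phi w t : cont phi -> loc_integrable w ->
  conv (fun nu => c * phi nu) w t = c * conv phi w t.
Proof.
  intros. unfold conv. rewrite <- RInt_mul_const by now apply conv_ex.
  apply RInt_ext; intros; apply Rmult_assoc.
Qed.

Lemma loc_integrable_plus w z : loc_integrable w -> loc_integrable z -> loc_integrable (fun s => w s + z s).
Proof.
  intros Hw Hz v a b Hv. eapply ex_RInt_ext.
  2: exact (ex_RInt_add _ _ a b (Hw v a b Hv) (Hz v a b Hv)). intros; simpl; ring.
Qed.

Lemma loc_integrable_scal c w : loc_integrable w -> loc_integrable (fun s => c * w s).
Proof.
  intros Hw v a b Hv. eapply ex_RInt_ext.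
  2: exact (ex_RInt_mul_const c _ a b (Hw v a b Hv)). intros; simpl; ring.
Qed.

Lemma conv_plus_r phi w z t : cont phi -> loc_integrable w -> loc_integrable z ->
  conv phi (fun s => w s + z s) t = conv phi w t + conv phi z t.
Proof.
  intros. unfold conv. rewrite <- RInt_add by now apply conv_ex.
  apply RInt_ext; intros; apply Rmult_plus_distr_l.
Qed.

Lemma conv_scal_r c phi w t : cont phi -> loc_integrable w ->
  conv phi (fun s => c * w s) t = c * conv phi w t.
Proof.
  intros. unfold conv. rewrite <- RInt_mul_const by now apply conv_ex.
  apply RInt_ext; intros; simpl; ring.
Qed.

Lemma conv_delay phi w d t : conv phi (fun s => w (s - d)) t = conv phi w (t - d).
Proof. apply RInt_ext. intros; f_equal; f_equal; ring. Qed.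

Lemma loc_integrable_delay w d : loc_integrable w -> loc_integrable (fun s => w (s - d)).
Proof. intros H. exact (loc_integrable_shift w (- d) H). Qed.

Lemma conv_comm phi psi w t : cont phi -> cont psi -> loc_integrable w ->
  conv phi (conv psi w) t = conv psi (conv phi w) t.
Proof.
  intros. rewrite !conv_conv by auto. f_equal; apply conv_ext_left; intros;
   auto using conv_head_comm, conv_tail_comm.
Qed.

(** * Decoupling of the closed loop *)

Section ClosedLoop.
Variables (a f0 f1 : R) (N M p g x U : R -> R).
Hypotheses (HN : cont N) (HM : cont M) (Hp : cont p) (Hg : cont g)
  (Hx : loc_integrable x) (HU : loc_integrable U).
Hypothesis head_zero : forall mu, 0 <= mu <= 1 ->
  g mu + N mu + f0 * M mu + conv_head M p mu - conv_head g N mu = 0.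
Hypothesis tail_zero : forall mu, 0 <= mu <= 1 ->
  a * g mu + f1 * M mu + conv_tail g N mu - conv_tail M p mu = 0.
Hypothesis plant_eq : forall t, 0 <= t ->
  x t = a * x (t - 1) + conv N x t + conv M U t.
Hypothesis control_eq : forall t, 0 <= t ->
  U t = conv p x t + conv g U t + f0 * x t - f1 * x (t - 1).

Lemma conv_plant phi t : cont phi -> 1 <= t ->
  conv phi x t = a * conv phi x (t - 1) + conv phi (conv N x) t + conv phi (conv M U) t.
Proof.
  intros Hphi Ht.
  rewrite (conv_ext_right phi x _ t (fun s Hs => plant_eq s ltac:(lra))).
  rewrite !conv_plus_r, conv_scal_r, conv_delay;
    auto using loc_integrable_plus, loc_integrable_scal, loc_integrable_delay, loc_integrable_conv.
Qed.

Lemma conv_control phi t : cont phi -> 1 <= t ->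
  conv phi U t = conv phi (conv p x) t + conv phi (conv g U) t
    + f0 * conv phi x t - f1 * conv phi x (t - 1).
Proof.
  intros Hphi Ht.
  rewrite (conv_ext_right phi U (fun s => conv p x s + conv g U s + f0 * x s + (- f1) * x (s - 1)) t).
  2: intros s Hs; rewrite (control_eq s) by lra; ring.
  rewrite !conv_plus_r, !conv_scal_r, conv_delay;
    auto using loc_integrable_plus, loc_integrable_scal, loc_integrable_delay, loc_integrable_conv. ring.
Qed.

Lemma head_kernel_zero w t : loc_integrable w -> conv g w t + conv N w t + f0 * conv M w t
  + conv (conv_head M p) w t - conv (conv_head g N) w t = 0.
Proof.
  intros Hw.
  assert (C1 : cont (conv_head M p)) by now apply cont_conv_head.
  assert (C2 : cont (conv_head g N)) by now apply cont_conv_head.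
  transitivity (conv (fun mu => g mu + N mu + f0 * M mu + conv_head M p mu + (-1) * conv_head g N mu) w t).
  - rewrite !conv_plus_l, !conv_scal_l; try assumption; cont_tac. ring.
  - rewrite (conv_ext_left _ (fun _ => 0 * 0) w t).
    2: intros nu Hnu; pose proof (head_zero nu Hnu); lra.
    rewrite conv_scal_l; auto. ring. apply cont_const.
Qed.

Lemma tail_kernel_zero w t : loc_integrable w -> a * conv g w t + f1 * conv M w t
  + conv (conv_tail g N) w t - conv (conv_tail M p) w t = 0.
Proof.
  intros Hw.
  assert (C1 : cont (conv_tail M p)) by now apply cont_conv_tail.
  assert (C2 : cont (conv_tail g N)) by now apply cont_conv_tail.
  transitivity (conv (fun mu => a * g mu + f1 * M mu + conv_tail g N mu + (-1) * conv_tail M p mu) w t).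
  - rewrite !conv_plus_l, !conv_scal_l; try assumption; cont_tac. ring.
  - rewrite (conv_ext_left _ (fun _ => 0 * 0) w t).
    2: intros nu Hnu; pose proof (tail_zero nu Hnu); lra.
    rewrite conv_scal_l; auto. ring. apply cont_const.
Qed.

(** Write [P] and [Q] for the two closed-loop equations, and [s f^] for
    [p^ + f0 - f1 exp (- s)].  In the variable [s] they read
    [F0 x - F1 U = 0] and [- s f^ x + (1 - g^) U = 0].  Applying the
    adjugate of this matrix, that is forming [(1 - g^) P + F1 Q] and
    [s f^ P + F0 Q], leaves its determinant acting on [x] and on [U]: the
    other terms cancel because convolutions commute, and the two hypotheses
    on the kernels say that the determinant is [1 - a exp (- s)].  From
    [t = 1] on the equations hold on all of [[t - 1, t]], as this needs. *)
Lemma closed_loop_decoupled t : 1 <= t -> x t = a * x (t - 1) /\ U t = a * U (t - 1).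
Proof.
  intros Ht. split.
  - pose proof (plant_eq t ltac:(lra)) as P0.
    pose proof (conv_plant g t Hg Ht) as Pg.
    pose proof (conv_control M t HM Ht) as QM.
    rewrite (conv_comm M g U t) in QM by auto.
    rewrite (conv_conv g N x t) in Pg by auto.
    rewrite (conv_conv M p x t) in QM by auto.
    pose proof (head_kernel_zero x t Hx). pose proof (tail_kernel_zero x (t - 1) Hx). lra.
  - pose proof (plant_eq t ltac:(lra)) as P0.
    pose proof (plant_eq (t - 1) ltac:(lra)) as P1.
    pose proof (control_eq t ltac:(lra)) as Q0.
    pose proof (control_eq (t - 1) ltac:(lra)) as Q1.
    pose proof (conv_plant p t Hp Ht) as Pp.
    pose proof (conv_control N t HN Ht) as QN.
    rewrite (conv_comm N p x t) in QN by auto.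
    rewrite (conv_comm N g U), (conv_conv g N) in QN by auto.
    rewrite (conv_comm p M U), (conv_conv M p U) in Pp by auto.
    pose proof (head_kernel_zero U t HU). pose proof (tail_kernel_zero U (t - 1) HU).
    assert (f0 * (x t - a * x (t-1) - conv N x t - conv M U t) = 0) by (rewrite P0; ring).
    assert (f1 * (x (t-1) - a * x (t-1-1) - conv N x (t-1) - conv M U (t-1)) = 0) by (rewrite P1 at 1; ring).
    assert (a * (U (t-1) - conv p x (t-1) - conv g U (t-1) - f0 * x (t-1) + f1 * x (t-1-1)) = 0) by (rewrite Q1 at 1; ring).
    lra.
Qed.
End ClosedLoop.

(** * Regularity of the data and of the solutions *)

(** On each piece the one-sided limits at the ends give a continuous extension,
    and the values at the breakpoints do not affect the integral. *)
Lemma pc_integrable a b phi v : piecewise_continuous a b phi -> cont v ->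
  ex_RInt (fun s => v s * phi s) a b.
Proof.
  intros [n [s [<- [<- H]]]] Hv.
  induction n as [|n IH].
  - apply ex_RInt_point.
  - apply (ex_RInt_Chasles _ _ (s n)).
    + apply IH. intros i Hi. apply H. lia.
    + destruct (H n ltac:(lia)) as [Hlt [Hc [[l1 Hl1] [l2 Hl2]]]].
      destruct (C0_extension_lt phi l1 l2 _ _ Hlt Hc Hl1 Hl2) as [h [Hh [Heq _]]].
      apply (ex_RInt_ext (fun x => v x * h x)).
      * rewrite Rmin_left, Rmax_right by lra. intros x Hx. now rewrite Heq.
      * apply cont_ex_RInt. apply cont_mult; auto.
Qed.

(** Integrability bounds [phi], so that the supremum is finite and [real]
    returns it. *)
Lemma le_norm_Cpw1 phi theta : Cpw1 phi -> -1 <= theta <= 0 -> Rabs (phi theta) <= norm_Cpw1 phi.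
Proof.
  intros Hphi Ht.
  pose proof (pc_integrable (-1) 0 phi (fun _ => 1) Hphi (cont_const 1)) as Hex.
  destruct (ex_RInt_ub _ _ _ Hex) as [B HB].
  rewrite Rmin_left, Rmax_right in HB by lra.
  unfold norm_Cpw1.
  set (E := fun y => exists theta : R, -1 <= theta <= 0 /\ y = Rabs (phi theta)).
  destruct (Lub_Rbar_correct E) as [Hub Hlub].
  assert (H1 : Rbar_le (Rabs (phi theta)) (Lub_Rbar E)) by (apply Hub; now exists theta).
  assert (H2 : Rbar_le (Lub_Rbar E) B).
  { apply Hlub. intros y [s [Hs ->]]. specialize (HB s Hs). simpl.
    unfold norm in HB; simpl in HB; unfold abs in HB; simpl in HB.
    rewrite Rmult_1_l in HB. exact HB. }
  destruct (Lub_Rbar E); simpl in *; tauto.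
Qed.

Lemma norm_Cpw1_le phi B : 0 <= B -> (forall theta, -1 <= theta <= 0 -> Rabs (phi theta) <= B) ->
  norm_Cpw1 phi <= B.
Proof.
  intros HB H. unfold norm_Cpw1.
  set (E := fun y => exists theta : R, -1 <= theta <= 0 /\ y = Rabs (phi theta)).
  destruct (Lub_Rbar_correct E) as [Hub Hlub].
  assert (H2 : Rbar_le (Lub_Rbar E) B).
  { apply Hlub. intros y [s [Hs ->]]. exact (H s Hs). }
  destruct (Lub_Rbar E); simpl in *; tauto.
Qed.

(** The extension by zero makes solutions integrable over every interval, so
    that no domain has to be tracked in the convolution identities. *)
Definition zero_ext (x : R -> R) (s : R) : R := if Rlt_dec s (-1) then 0 else x s.

Lemma zero_ext_eq x s : -1 <= s -> zero_ext x s = x s.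
Proof. intros H. unfold zero_ext. destruct (Rlt_dec s (-1)); lra. Qed.

Lemma history_integrable x t v : Cpw1 (history x t) -> cont v ->
  ex_RInt (fun s => v s * x s) (t - 1) t.
Proof.
  intros H Hv.
  assert (Hex : ex_RInt (fun s => v (s + t) * history x t s) (-1) 0).
  { apply pc_integrable; auto. cont_tac. }
  replace (-1) with (1 * (t - 1) + - t) in Hex by ring.
  replace 0 with (1 * t + - t) in Hex by ring.
  apply (ex_RInt_comp_lin _ 1 (- t)) in Hex.
  eapply ex_RInt_ext; [|exact Hex]. intros s _. unfold history.
  unfold scal; simpl; unfold mult; simpl.
  replace (1 * s + - t + t) with s by ring. replace (t + (1 * s + - t)) with s by ring. ring.
Qed.

Lemma loc_integrable_zero_ext x : (forall t, 0 <= t -> Cpw1 (history x t)) -> loc_integrable (zero_ext x).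
Proof.
  intros H v a b Hv.
  assert (Hn : forall n, ex_RInt (fun s => v s * zero_ext x s) (-1) (INR n)).
  { intros n. induction n as [|n IH].
    - pose proof (history_integrable x 0 v (H 0 (Rle_refl 0)) Hv) as Hex.
      replace (0 - 1) with (-1) in Hex by ring.
      eapply ex_RInt_ext; [|exact Hex]. simpl. rewrite Rmin_left, Rmax_right by lra.
      intros s Hs. rewrite zero_ext_eq; lra.
    - apply (ex_RInt_Chasles _ _ (INR n)); auto.
      pose proof (history_integrable x (INR (S n)) v (H _ (pos_INR _)) Hv) as Hex.
      rewrite S_INR in *. replace (INR n + 1 - 1) with (INR n) in Hex by ring.
      eapply ex_RInt_ext; [|exact Hex]. rewrite Rmin_left, Rmax_right by lra.
      pose proof (pos_INR n). intros s Hs. rewrite zero_ext_eq; lra. }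
  assert (Hb : forall b, ex_RInt (fun s => v s * zero_ext x s) (-1) b).
  { intros c. destruct (Rlt_dec c (-1)) as [Hc|Hc].
    - apply (ex_RInt_ext (fun _ => 0)). 2: apply ex_RInt_const.
      rewrite Rmin_right, Rmax_left by lra. intros s Hs. unfold zero_ext.
      destruct (Rlt_dec s (-1)); lra.
    - destruct (INR_unbounded c) as [n Hn'].
      apply (@ex_RInt_Chasles_1 R_CompleteNormedModule _ _ _ (INR n)). lra. apply Hn. }
  apply (ex_RInt_Chasles _ _ (-1)). apply ex_RInt_swap. apply Hb. apply Hb.
Qed.

Lemma continuous_extension a b phi : a < b -> continuous_on (Icc a b) phi ->
  exists h, cont h /\ forall s, a <= s <= b -> h s = phi s.
Proof.
  intros Hab H. assert (Hba : 0 < b - a) by lra.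
  destruct (C0_extension_lt phi (phi a) (phi b) a b Hab) as [h [Hh [Heq [Ha Hb]]]].
  - intros c Hc. apply (continuous_continuous_on (Icc a b) phi c); auto.
    apply (locally_interval _ c a b); simpl; try tauto. intros y; unfold Icc; simpl; lra.
  - intros P HP. specialize (H a (conj (Rle_refl a) (Rlt_le _ _ Hab)) P HP).
    unfold filtermap, within, at_right in *.
    destruct H as [d Hd].
    exists (mkposreal (Rmin d (b - a)) (Rmin_pos d (b - a) (cond_pos d) Hba)).
    intros y Hy Hlt. apply Hd.
    + eapply ball_le; [|exact Hy]. apply Rmin_l.
    + unfold Icc. simpl in Hy. unfold ball in Hy; simpl in Hy; unfold AbsRing_ball, abs, minus, plus, opp in Hy; simpl in Hy.
      apply Rabs_def2 in Hy. pose proof (Rmin_r d (b - a)). lra.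
  - intros P HP. specialize (H b (conj (Rlt_le _ _ Hab) (Rle_refl b)) P HP).
    unfold filtermap, within, at_left in *.
    destruct H as [d Hd].
    exists (mkposreal (Rmin d (b - a)) (Rmin_pos d (b - a) (cond_pos d) Hba)).
    intros y Hy Hlt. apply Hd.
    + eapply ball_le; [|exact Hy]. apply Rmin_l.
    + unfold Icc. simpl in Hy. unfold ball in Hy; simpl in Hy; unfold AbsRing_ball, abs, minus, plus, opp in Hy; simpl in Hy.
      apply Rabs_def2 in Hy. pose proof (Rmin_r d (b - a)). lra.
  - exists h; split; auto. intros s Hs.
    destruct (Req_dec s a) as [->|]; auto. destruct (Req_dec s b) as [->|]; auto.
    apply Heq; lra.
Qed.

Lemma is_derive_on_continuous a b f f' : is_derive_on a b f f' -> continuous_on (Icc a b) f.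
Proof.
  intros H s Hs. specialize (H s Hs).
  apply (@filterdiff_continuous_aux _ _ _ (within (Icc a b) (locally s)) _ f).
  - now exists (fun h => scal h (f' s)).
  - intros P HP. unfold within. apply filter_imp with (2 := HP). auto.
Qed.

Lemma is_derive_on_interior a b f f' s : is_derive_on a b f f' -> a < s < b ->
  is_derive f s (f' s).
Proof.
  intros H Hs. destruct (H s ltac:(unfold Icc; lra)) as [Hlin Hdom].
  split; auto. intros y Hy eps.
  pose proof (@is_filter_lim_locally_unique R_AbsRing R_NormedModule s y Hy) as Hsy. subst y.
  assert (Hl : locally s (Icc a b)).
  { apply (locally_interval _ s a b); simpl; try tauto. intros y; unfold Icc; simpl; lra. }
  assert (Hlim : is_filter_lim (within (Icc a b) (locally s)) s).
  { intros P HP. unfold within. apply filter_imp with (2 := HP). auto. }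
  specialize (Hdom s Hlim eps). unfold within in Hdom.
  generalize (filter_and _ _ Hl Hdom). apply filter_imp. intros y [H1 H2]. exact (H2 H1).
Qed.

(** With [p] a continuous extension of the derivative, the primitive of [p]
    that takes the value [f a] at [a] differs from [f] by a function that is
    continuous on [[a,b]] and has zero derivative inside, hence by zero.
    The given [f'] is compared with [p] on the open interval only, where the
    derivative is two-sided and unique; this is enough under integral signs. *)
Lemma C1_extension a b f f' : a < b -> Ck_on 1 a b f -> is_derive_on a b f f' ->
  exists F p, cont p /\ (forall s, is_derive F s (p s)) /\
    (forall s, a <= s <= b -> F s = f s) /\ (forall s, a < s < b -> p s = f' s).
Proof.
  intros Hab [f'' [Hf'' Hc]] Hf'.
  destruct (continuous_extension a b f'' Hab Hc) as [p [Hp Hpe]].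
  destruct (continuous_extension a b f Hab (is_derive_on_continuous _ _ _ _ Hf')) as [fe [Hfe Hfee]].
  set (F := fun s => fe a + RInt p a s).
  assert (HF : forall s, is_derive F s (p s)).
  { intros s. unfold F. rewrite <- (Rplus_0_l (p s)).
    apply (is_derive_plus (fun _ => fe a) (fun s => RInt p a s)).
    apply (is_derive_const (fe a) s).
    apply (is_derive_RInt p (fun s => RInt p a s) a s).
    - exists (mkposreal 1 Rlt_0_1). intros y _. apply (RInt_correct p). now apply cont_ex_RInt.
    - apply Hp. }
  exists F, p. split; [|split; [|split]]; auto.
  - intros s Hs. rewrite <- Hfee by auto.
    destruct (MVT_gen (fun y => F y - fe y) a s (fun _ => 0)) as [c [_ Hc']].
    + rewrite Rmin_left, Rmax_right by lra. intros y Hy.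
      replace 0 with (p y - f'' y) by (rewrite Hpe by lra; ring).
      apply (is_derive_minus F fe); auto.
      apply (is_derive_ext_loc f).
      * apply (locally_interval _ y a b); simpl; try lra. intros z Hz1 Hz2. symmetry; apply Hfee; simpl in *; lra.
      * apply (is_derive_on_interior a b); auto. lra.
    + intros y _. apply continuity_pt_filterlim.
      apply (continuous_minus F fe y). 2: apply Hfe.
      apply (ex_derive_continuous F). eexists; apply HF.
    + assert (F a = fe a). { unfold F. rewrite (RInt_point a p : _ = 0). ring. } lra.
  - intros s Hs. rewrite Hpe by lra.
    rewrite <- (is_derive_unique _ _ _ (is_derive_on_interior a b f f' s Hf' Hs)).
    symmetry. apply is_derive_unique. now apply (is_derive_on_interior a b).
Qed.

Lemma integration_by_parts F p M q a b c : cont p -> cont q ->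
  (forall s, is_derive F s (p s)) -> (forall s, is_derive M s (q s)) ->
  RInt (fun nu => p nu * M (c - nu)) a b =
  F b * M (c - b) - F a * M (c - a) + RInt (fun nu => F nu * q (c - nu)) a b.
Proof.
  intros Hp Hq HF HM.
  assert (CF : cont F) by (intros s; apply (ex_derive_continuous F); eexists; apply HF).
  assert (CM : cont M) by (intros s; apply (ex_derive_continuous M); eexists; apply HM).
  assert (H : is_RInt (fun nu => p nu * M (c - nu) - F nu * q (c - nu)) a b
    (minus (F b * M (c - b)) (F a * M (c - a)))).
  { apply (is_RInt_derive (fun nu => F nu * M (c - nu))).
    - intros s _.
      assert (HMc : is_derive (fun nu => M (c - nu)) s (- q (c - s))).
      { replace (- q (c - s)) with ((-1) * q (c - s)) by ring.
        apply (is_derive_comp M (fun nu => c - nu)). apply HM.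
        auto_derive; auto. }
      pose proof (is_derive_mult F (fun nu => M (c - nu)) s _ _ (HF s) HMc Rmult_comm) as Hd.
      replace (p s * M (c - s) - F s * q (c - s)) with (plus (mult (p s) (M (c - s))) (mult (F s) (- q (c - s)))).
      exact Hd. unfold plus, mult; simpl; ring.
    - intros s _. revert s. change (cont (fun nu => p nu * M (c - nu) - F nu * q (c - nu))). cont_tac. }
  apply (@is_RInt_unique R_CompleteNormedModule) in H. rewrite RInt_sub in H.
  - unfold minus, plus, opp in H; simpl in H. lra.
  - apply cont_ex_RInt. cont_tac.
  - apply cont_ex_RInt. cont_tac.
Qed.

(** * Growth on the first interval and decay *)

(** The weight [exp (lam * s)] makes the memory term small: integrating it
    over [[t - 1, t]] gains a factor [1 / lam]. *)
Lemma conv_bound phi w t C D S lam : loc_integrable w -> cont phi -> 0 < lam -> 0 <= S ->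
  (forall nu, 0 <= nu <= 1 -> Rabs (phi nu) <= C) ->
  (forall s, t - 1 <= s <= t -> Rabs (w s) <= D + S * exp (lam * s)) ->
  Rabs (conv phi w t) <= C * (D + S * exp (lam * t) / lam).
Proof.
  intros Hw Hphi Hlam HS HC HD.
  assert (HI : is_RInt (fun nu => C * (D + S * exp (lam * (t - nu)))) 0 1
    (minus (C * (D * 1 - S * exp (lam * (t - 1)) / lam)) (C * (D * 0 - S * exp (lam * (t - 0)) / lam)))).
  { apply (is_RInt_derive (fun nu => C * (D * nu - S * exp (lam * (t - nu)) / lam))).
    - intros s _. auto_derive; auto. unfold Rminus; field; lra.
    - intros s _. apply (ex_derive_continuous (fun nu => C * (D + S * exp (lam * (t - nu))))).
      auto_derive; auto. }
  assert (C0 : 0 <= C).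
  { eapply Rle_trans; [apply Rabs_pos | apply (HC 0); lra]. }
  eapply Rle_trans.
  - apply (norm_RInt_le (fun nu => phi nu * w (t - nu)) _ 0 1 (conv phi w t) _ Rle_0_1) with (3 := HI).
    + intros nu Hnu. unfold norm; simpl; unfold abs; simpl. rewrite Rabs_mult.
      apply Rmult_le_compat; try apply Rabs_pos; auto. apply HD; lra.
    + apply (RInt_correct (fun nu => phi nu * w (t - nu))). now apply conv_ex.
  - unfold minus, plus, opp; simpl. rewrite <- Ropp_mult_distr_r_reverse || idtac.
    replace (t - 0) with t by ring.
    assert (0 <= C * (S * exp (lam * (t - 1)) / lam)).
    { apply Rmult_le_pos; auto. apply Rmult_le_pos. apply Rmult_le_pos; auto. apply Rlt_le, exp_pos.
      apply Rlt_le, Rinv_0_lt_compat; lra. }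
    lra.
Qed.

(** Gronwall's inequality for the two equations on [[0,1]], with the histories
    bounded by [D].  Let [S] be the supremum of
    [(|x t| + |U t|) * exp (- lam * t)].  Inserting the bound that [S] gives into
    the right-hand sides returns [S <= k * D + (k / lam) * S], and [lam = 2 * k]
    absorbs the last term. *)
Lemma growth_bound a f0 f1 N M p g : cont N -> cont M -> cont p -> cont g ->
  exists k, 1 <= k /\ forall x U D, loc_integrable x -> loc_integrable U ->
    (forall s, -1 <= s < 0 -> Rabs (x s) + Rabs (U s) <= D) ->
    (forall t, 0 <= t -> x t = a * x (t - 1) + conv N x t + conv M U t) ->
    (forall t, 0 <= t -> U t = conv p x t + conv g U t + f0 * x t - f1 * x (t - 1)) ->
    forall t, 0 <= t <= 1 -> Rabs (x t) + Rabs (U t) <= k * D.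
Proof.
  intros HN HM Hp Hg.
  destruct (loc_integrable_bound N 0 1 (loc_integrable_cont N HN)) as [CN [CN0 HCN]].
  destruct (loc_integrable_bound M 0 1 (loc_integrable_cont M HM)) as [CM [CM0 HCM]].
  destruct (loc_integrable_bound p 0 1 (loc_integrable_cont p Hp)) as [Cp [Cp0 HCp]].
  destruct (loc_integrable_bound g 0 1 (loc_integrable_cont g Hg)) as [Cg [Cg0 HCg]].
  set (kx := Rabs a + CN + CM).
  set (kU := Cp + Cg + Rabs f0 * kx + Rabs f1).
  set (k := kx + kU + 1).
  pose proof (Rabs_pos a). pose proof (Rabs_pos f0). pose proof (Rabs_pos f1).
  assert (Hkx : 0 <= kx) by (unfold kx; lra).
  assert (HkU : 0 <= kU).
  { unfold kU. assert (0 <= Rabs f0 * kx) by now apply Rmult_le_pos. lra. }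
  assert (Hk : 1 <= k) by (unfold k; lra).
  (* so that k * (S * exp (lam * t) / lam) is half of S * exp (lam * t) *)
  set (lam := 2 * k).
  assert (Hlam : 0 < lam) by (unfold lam; lra).
  exists (2 * k * exp lam). split.
  { assert (1 <= exp lam). { rewrite <- exp_0. apply Rlt_le, exp_increasing; lra. }
    rewrite <- (Rmult_1_l 1). apply Rmult_le_compat; lra. }
  intros x U D Hx HU HD Hplant Hctrl.
  assert (HD0 : 0 <= D).
  { specialize (HD (-1) ltac:(lra)). pose proof (Rabs_pos (x (-1))). pose proof (Rabs_pos (U (-1))). lra. }
  set (y := fun t => Rabs (x t) + Rabs (U t)).
  set (E := fun r => exists t, 0 <= t <= 1 /\ r = y t * exp (- (lam * t))).
  destruct (loc_integrable_bound x 0 1 Hx) as [Bx [Bx0 HBx]].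
  destruct (loc_integrable_bound U 0 1 HU) as [BU [BU0 HBU]].
  assert (Hy0 : forall t, 0 <= y t).
  { intros t. unfold y. pose proof (Rabs_pos (x t)). pose proof (Rabs_pos (U t)). lra. }
  assert (Hdec : forall t, 0 <= t -> exp (- (lam * t)) <= 1).
  { intros t Ht. rewrite <- exp_0. assert (0 <= lam * t) by (apply Rmult_le_pos; lra).
    destruct (Req_dec (lam * t) 0) as [->|]. rewrite Ropp_0; lra.
    apply Rlt_le, exp_increasing; lra. }
  destruct (completeness E) as [S [HSub HSlub]].
  { exists (Bx + BU). intros r [t [Ht ->]]. rewrite <- (Rmult_1_r (Bx + BU)).
    apply Rmult_le_compat; auto. apply Rlt_le, exp_pos.
    unfold y. specialize (HBx t Ht); specialize (HBU t Ht); lra.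
    apply Hdec; lra. }
  { exists (y 0 * exp (- (lam * 0))). exists 0. split; auto; lra. }
  assert (HS : forall t, 0 <= t <= 1 -> y t <= S * exp (lam * t)).
  { intros t Ht. assert (Hr : y t * exp (- (lam * t)) <= S) by (apply HSub; exists t; auto).
    apply (Rmult_le_compat_r (exp (lam * t))) in Hr. 2: apply Rlt_le, exp_pos.
    rewrite Rmult_assoc, <- exp_plus, Rplus_opp_l, exp_0, Rmult_1_r in Hr. exact Hr. }
  assert (HS0 : 0 <= S).
  { specialize (HS 0 ltac:(lra)). rewrite Rmult_0_r, exp_0, Rmult_1_r in HS. specialize (Hy0 0). lra. }
  assert (Hall : forall s, -1 <= s <= 1 -> y s <= D + S * exp (lam * s)).
  { intros s Hs. assert (0 <= S * exp (lam * s)) by (apply Rmult_le_pos; [lra | apply Rlt_le, exp_pos]).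
    destruct (Rlt_dec s 0). specialize (HD s ltac:(lra)). unfold y; lra.
    specialize (HS s ltac:(lra)). lra. }
  assert (Hxs : forall s, -1 <= s <= 1 -> Rabs (x s) <= D + S * exp (lam * s)).
  { intros s Hs. specialize (Hall s Hs). unfold y in Hall. pose proof (Rabs_pos (U s)). lra. }
  assert (HUs : forall s, -1 <= s <= 1 -> Rabs (U s) <= D + S * exp (lam * s)).
  { intros s Hs. specialize (Hall s Hs). unfold y in Hall. pose proof (Rabs_pos (x s)). lra. }
  assert (Hstep : forall t, 0 <= t <= 1 -> y t <= k * D + S / 2 * exp (lam * t)).
  { intros t Ht. set (e := D + S * exp (lam * t) / lam).
    assert (He : 0 <= S * exp (lam * t) / lam).
    { apply Rmult_le_pos. apply Rmult_le_pos; auto. apply Rlt_le, exp_pos.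
      apply Rlt_le, Rinv_0_lt_compat; lra. }
    assert (Hd : Rabs (x (t - 1)) <= e).
    { eapply Rle_trans; [apply Hxs; lra|]. unfold e. apply Rplus_le_compat_l.
      unfold Rdiv. rewrite Rmult_assoc. apply Rmult_le_compat_l; auto.
      replace (lam * (t - 1)) with (lam * t + - lam) by ring. rewrite exp_plus.
      apply Rmult_le_compat_l. apply Rlt_le, exp_pos. rewrite exp_Ropp.
      apply Rinv_le_contravar; auto. pose proof (exp_ineq1 lam ltac:(lra)). lra. }
    assert (B1 : Rabs (conv N x t) <= CN * e) by (apply conv_bound; auto; intros; apply Hxs; lra).
    assert (B2 : Rabs (conv M U t) <= CM * e) by (apply conv_bound; auto; intros; apply HUs; lra).
    assert (B3 : Rabs (conv p x t) <= Cp * e) by (apply conv_bound; auto; intros; apply Hxs; lra).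
    assert (B4 : Rabs (conv g U t) <= Cg * e) by (apply conv_bound; auto; intros; apply HUs; lra).
    assert (He0 : 0 <= e) by (unfold e; lra).
    assert (Hxt : Rabs (x t) <= kx * e).
    { rewrite (Hplant t) by lra. eapply Rle_trans; [apply Rabs_triang|].
      pose proof (Rabs_triang (a * x (t - 1)) (conv N x t)) as HT. rewrite Rabs_mult in HT.
      assert (Rabs a * Rabs (x (t - 1)) <= Rabs a * e) by (apply Rmult_le_compat_l; auto).
      unfold kx. lra. }
    assert (HUt : Rabs (U t) <= kU * e).
    { rewrite (Hctrl t) by lra. unfold Rminus at 1.
      eapply Rle_trans; [apply Rabs_triang|]. rewrite Rabs_Ropp, Rabs_mult.
      pose proof (Rabs_triang (conv p x t + conv g U t) (f0 * x t)) as HT. rewrite Rabs_mult in HT.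
      pose proof (Rabs_triang (conv p x t) (conv g U t)) as HT2.
      assert (Rabs f0 * Rabs (x t) <= Rabs f0 * (kx * e)) by (apply Rmult_le_compat_l; auto).
      assert (Rabs f1 * Rabs (x (t - 1)) <= Rabs f1 * e) by (apply Rmult_le_compat_l; auto).
      unfold kU. lra. }
    assert (Hke : k * e = k * D + S / 2 * exp (lam * t)) by (unfold e, lam; field; lra).
    unfold y. rewrite <- Hke. unfold k. lra. }
  assert (HSk : S <= 2 * k * D).
  { assert (S <= k * D + S / 2); [|lra].
    apply HSlub. intros r [t [Ht ->]]. specialize (Hstep t Ht).
    apply (Rmult_le_compat_r (exp (- (lam * t)))) in Hstep. 2: apply Rlt_le, exp_pos.
    eapply Rle_trans; [exact Hstep|].
    assert (Hinv : exp (lam * t) * exp (- (lam * t)) = 1)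
      by (rewrite <- exp_plus, Rplus_opp_r; apply exp_0).
    assert (HkD : k * D * exp (- (lam * t)) <= k * D * 1).
    { apply Rmult_le_compat_l; [apply Rmult_le_pos; lra | apply Hdec; lra]. }
    replace ((k * D + S / 2 * exp (lam * t)) * exp (- (lam * t)))
      with (k * D * exp (- (lam * t)) + S / 2 * (exp (lam * t) * exp (- (lam * t)))) by ring.
    rewrite Hinv. lra. }
  intros t Ht. apply Rle_trans with (S * exp (lam * t)). exact (HS t Ht).
  replace (2 * k * exp lam * D) with (2 * k * D * exp lam) by ring.
  apply Rmult_le_compat; auto. apply Rlt_le, exp_pos.
  destruct (Req_dec t 1) as [->|]. rewrite Rmult_1_r; lra.
  apply Rlt_le, exp_increasing. rewrite <- (Rmult_1_r lam) at 2. apply Rmult_lt_compat_l; lra.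
Qed.

Lemma exponential_decay y b kappa D : 0 <= D -> 0 < kappa -> exp (- kappa) = b ->
  (forall t, -1 <= t < 1 -> y t <= D) ->
  (forall t, 1 <= t -> y t <= b * y (t - 1)) ->
  forall t, -1 <= t -> y t <= D * exp kappa * exp (- kappa * t).
Proof.
  intros HD Hk Hb H0 H1.
  assert (Hn : forall n t, -1 <= t < INR n + 1 -> y t <= D * exp kappa * exp (- kappa * t)).
  { induction n as [|n IH]; intros t Ht.
    - simpl in Ht. eapply Rle_trans; [apply H0; lra|].
      rewrite Rmult_assoc, <- exp_plus. rewrite <- (Rmult_1_r D) at 1.
      apply Rmult_le_compat_l; auto. rewrite <- exp_0.
      assert (0 < kappa * (1 - t)) by (apply Rmult_lt_0_compat; lra).
      apply Rlt_le, exp_increasing. lra.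
    - rewrite S_INR in Ht. destruct (Rlt_dec t 1) as [Hlt|Hge].
      + apply IH. pose proof (pos_INR n). lra.
      + eapply Rle_trans; [apply H1; lra|]. specialize (IH (t - 1) ltac:(lra)).
        replace (D * exp kappa * exp (- kappa * t)) with (b * (D * exp kappa * exp (- kappa * (t - 1)))).
        * apply Rmult_le_compat_l; auto. rewrite <- Hb. apply Rlt_le, exp_pos.
        * replace (- kappa * t) with (- kappa + - kappa * (t - 1)) by ring.
          rewrite exp_plus, Hb. ring. }
  intros t Ht. destruct (INR_unbounded t) as [n Hn']. apply (Hn n). lra.
Qed.

(** * Exponential stability *)

Theorem theorem2 (a : R) (N M M' f f' g : R -> R)
  (ha : -1 < a < 1)
  (hN : Ck_on 2 0 1 N)
  (hM : Ck_on 2 0 1 M)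
  (hM' : is_derive_on 0 1 M M')
  (hrank : forall s : C, ~ (F0 a N s = RtoC 0 /\ F1 M s = RtoC 0))
  (haM : a * M 0 - M 1 <> 0)
  (hF00 : F0 a N (RtoC 0) <> RtoC 0)
  (hf : Ck_on 1 0 1 f)
  (hf' : is_derive_on 0 1 f f')
  (hg : Ck_on 1 0 1 g)
  (hI1 : forall nu : R, 0 <= nu <= 1 -> I1 N M M' f g nu = 0)
  (hI3 : forall nu : R, 1 <= nu <= 2 -> I3 a N M M' f g nu = 0) :
  closed_loop_exponentially_stable a N M f f' g.
Proof.
  assert (hM1 : Ck_on 1 0 1 M).
  { destruct hM as [m [Hm [m' [Hm' _]]]]. exists m. split; auto.
    exact (is_derive_on_continuous _ _ _ _ Hm'). }
  destruct (C1_extension 0 1 M M' Rlt_0_1 hM1 hM') as [Me [q [Cq [HMe [EM Eq]]]]].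
  destruct (C1_extension 0 1 f f' Rlt_0_1 hf hf') as [fe [p [Cp [Hfe [Ef Ep]]]]].
  destruct hN as [n' [Hn' _]]. destruct hg as [g' [Hg' _]].
  destruct (continuous_extension 0 1 N Rlt_0_1 (is_derive_on_continuous _ _ _ _ Hn')) as [Ne [CN EN]].
  destruct (continuous_extension 0 1 g Rlt_0_1 (is_derive_on_continuous _ _ _ _ Hg')) as [ge [Cg Eg]].
  assert (CM : cont Me) by (intros s; apply (ex_derive_continuous Me); eexists; apply HMe).
  assert (Cf : cont fe) by (intros s; apply (ex_derive_continuous fe); eexists; apply Hfe).
  assert (head_zero : forall mu, 0 <= mu <= 1 ->
    ge mu + Ne mu + f 0 * Me mu + conv_head Me p mu - conv_head ge Ne mu = 0).
  { intros mu Hmu. rewrite conv_head_comm by auto. unfold conv_head.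
    rewrite (integration_by_parts fe p Me q) by auto.
    (* integrating by parts trades M and f' for M' and f, the form in I1 and I3 *)
    pose proof (hI1 mu Hmu) as H1. unfold I1 in H1.
    rewrite (RInt_ext (fun eta => f eta * M' (mu - eta)) (fun eta => fe eta * q (mu - eta))) in H1.
    rewrite (RInt_ext (fun eta => g eta * N (mu - eta)) (fun eta => ge eta * Ne (mu - eta))) in H1.
    rewrite Rminus_diag, Rminus_0_r, !Ef, !EM, EN, Eg by lra. lra.
    all: rewrite Rmin_left, Rmax_right by lra; intros s Hs.
    - rewrite Eg, EN; lra.
    - rewrite Ef, Eq; lra. }
  assert (tail_zero : forall mu, 0 <= mu <= 1 ->
    a * ge mu + f 1 * Me mu + conv_tail ge Ne mu - conv_tail Me p mu = 0).
  { intros mu Hmu. rewrite (conv_tail_comm Me p) by auto. unfold conv_tail.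
    rewrite (integration_by_parts fe p Me q) by auto.
    pose proof (hI3 (1 + mu) ltac:(lra)) as H3. unfold I3 in H3.
    replace (1 + mu - 1) with mu in * by ring.
    rewrite (RInt_ext (fun eta => f eta * M' (1 + mu - eta)) (fun eta => fe eta * q (1 + mu - eta))) in H3.
    rewrite (RInt_ext (fun eta => g eta * N (1 + mu - eta)) (fun eta => ge eta * Ne (1 + mu - eta))) in H3.
    replace (1 + mu - mu) with 1 by ring.
    rewrite !Ef, !EM, Eg by lra. lra.
    all: rewrite Rmin_left, Rmax_right by lra; intros s Hs.
    - rewrite Eg, EN; lra.
    - rewrite Ef, Eq; lra. }
  destruct (growth_bound a (f 0) (f 1) Ne Me p ge CN CM Cp Cg) as [k [Hk Hgrowth]].
  (* the decay rate is - ln b; the 1/2 covers small |a|, in particular a = 0 *)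
  set (b := Rmax (Rabs a) (1 / 2)).
  assert (Hb : 0 < b < 1).
  { unfold b. pose proof (Rmax_r (Rabs a) (1/2)). split. lra.
    apply Rmax_lub_lt. apply Rabs_def1; lra. lra. }
  assert (Hab : Rabs a <= b) by apply Rmax_l.
  exists (- ln b), (2 * k * exp (- ln b) * exp (- ln b)).
  assert (Hkap : 0 < - ln b).
  { assert (ln b < 0). rewrite <- ln_1. apply ln_increasing; lra. lra. }
  split; auto. split.
  { pose proof (exp_pos (- ln b)). repeat apply Rmult_lt_0_compat; lra. }
  set (kappa := - ln b) in *.
  assert (Hexp : exp (- kappa) = b) by (unfold kappa; rewrite Ropp_involutive; apply exp_ln; lra).
  intros x0 U0 Hx0 HU0 x U [Hpc [Hini Heq]] t Ht.
  set (D := norm_Cpw1 x0 + norm_Cpw1 U0).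
  set (xe := zero_ext x). set (Ue := zero_ext U).
  assert (Lx : loc_integrable xe) by (apply loc_integrable_zero_ext; intros s Hs; apply Hpc; auto).
  assert (LU : loc_integrable Ue) by (apply loc_integrable_zero_ext; intros s Hs; apply Hpc; auto).
  assert (HD : forall s, -1 <= s < 0 -> Rabs (xe s) + Rabs (Ue s) <= D).
  { intros s Hs. unfold xe, Ue. rewrite !zero_ext_eq by lra.
    destruct (Hini s Hs) as [-> ->]. apply Rplus_le_compat; apply le_norm_Cpw1; auto; lra. }
  assert (HP : forall t, 0 <= t -> xe t = a * xe (t - 1) + conv Ne xe t + conv Me Ue t).
  { intros s Hs. destruct (Heq s Hs) as [HP _]. unfold plant in HP.
    unfold xe at 1 2. rewrite !zero_ext_eq, HP by lra. unfold conv.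
    f_equal; [f_equal|]; apply RInt_ext; rewrite Rmin_left, Rmax_right by lra; intros nu Hnu;
      unfold xe, Ue; rewrite zero_ext_eq by lra; [rewrite EN | rewrite EM]; lra. }
  assert (HQ : forall t, 0 <= t -> Ue t = conv p xe t + conv ge Ue t + f 0 * xe t - f 1 * xe (t - 1)).
  { intros s Hs. destruct (Heq s Hs) as [_ HQ]. unfold control_law in HQ.
    unfold Ue at 1. unfold xe at 2 3. rewrite !zero_ext_eq, HQ by lra. unfold conv.
    rewrite <- RInt_add by now apply conv_ex.
    f_equal. f_equal. apply RInt_ext; rewrite Rmin_left, Rmax_right by lra; intros nu Hnu.
    unfold xe, Ue; rewrite !zero_ext_eq by lra. rewrite Ep, Eg; lra. }
  set (y := fun s => Rabs (xe s) + Rabs (Ue s)).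
  assert (HD0 : 0 <= D).
  { specialize (HD (-1) ltac:(lra)). pose proof (Rabs_pos (xe (-1))). pose proof (Rabs_pos (Ue (-1))). lra. }
  assert (HkD : D <= k * D). { rewrite <- (Rmult_1_l D) at 1. apply Rmult_le_compat_r; auto. }
  assert (Hdecay : forall s, -1 <= s -> y s <= k * D * exp kappa * exp (- kappa * s)).
  { apply (exponential_decay y b); auto. lra.
    - intros s Hs. destruct (Rlt_dec s 0).
      + specialize (HD s ltac:(lra)). unfold y; lra.
      + exact (Hgrowth xe Ue D Lx LU HD HP HQ s ltac:(lra)).
    - intros s Hs.
      destruct (closed_loop_decoupled a (f 0) (f 1) Ne Me p ge xe Ue CN CM Cp Cg Lx LU head_zero tail_zero HP HQ s Hs) as [E1 E2].
      unfold y. rewrite E1, E2, !Rabs_mult.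
      rewrite <- Rmult_plus_distr_l. apply Rmult_le_compat_r; auto.
      pose proof (Rabs_pos (xe (s-1))). pose proof (Rabs_pos (Ue (s-1))). lra. }
  set (B := k * D * exp kappa * (exp kappa * exp (- kappa * t))).
  assert (HyB : forall theta, -1 <= theta <= 0 -> y (t + theta) <= B).
  { intros th Hth. eapply Rle_trans; [apply Hdecay; lra|]. unfold B.
    apply Rmult_le_compat_l.
    - apply Rmult_le_pos. lra. apply Rlt_le, exp_pos.
    - rewrite <- exp_plus. destruct (Req_dec th (-1)) as [->|].
      right; f_equal; ring. apply Rlt_le, exp_increasing.
      assert (0 < kappa * (1 + th)) by (apply Rmult_lt_0_compat; lra). lra. }
  assert (HB0 : 0 <= B).
  { specialize (HyB 0 ltac:(lra)). unfold y in HyB.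
    pose proof (Rabs_pos (xe (t+0))). pose proof (Rabs_pos (Ue (t+0))). lra. }
  assert (N1 : norm_Cpw1 (history x t) <= B).
  { apply norm_Cpw1_le; auto. intros th Hth. specialize (HyB th Hth). unfold y, xe, Ue in HyB.
    rewrite !zero_ext_eq in HyB by lra. unfold history. pose proof (Rabs_pos (U (t + th))). lra. }
  assert (N2 : norm_Cpw1 (history U t) <= B).
  { apply norm_Cpw1_le; auto. intros th Hth. specialize (HyB th Hth). unfold y, xe, Ue in HyB.
    rewrite !zero_ext_eq in HyB by lra. unfold history. pose proof (Rabs_pos (x (t + th))). lra. }
  replace (2 * k * exp kappa * exp kappa * exp (- kappa * t) * D) with (B + B) by (unfold B; ring).
  lra.
Qed.
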